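(* Let $r_1,r_2,r_3\geq 1$ and $r_4\geq 0$ be integers with $r_1+r_2+r_3+r_4=2l+1$. Every invariant Riemannian metric $g$ on $SO(2l+1)/(SO(r_1)\times SO(r_2)\times SO(r_3)\times SO(r_4))$ which is adapted to the $(\mathbb{Z}_2\times\mathbb{Z}_2)$-symmetric structure is given by an inner product $B$ on $\mathfrak{m}=\mathfrak{g}_a\oplus\mathfrak{g}_b\oplus\mathfrak{g}_c$ of the form $$B=t\Big(\sum(\alpha^1_{ij})^2+\sum(\alpha^2_{ij})^2+\sum(\beta^1_{ij})^2+\sum(\beta^2_{ij})^2+\sum(\gamma^1_{ij})^2+\sum(\gamma^2_{ij})^2\Big)$$ with $t>0$.
   Context: Decompose a matrix of $so(2l+1)$ into blocks of sizes $r_1,r_2,r_3,r_4$: $$\begin{pmatrix}X_1&A_1&B_1&C_1\\-{}^tA_1&X_2&C_2&B_2\\-{}^tB_1&-{}^tC_2&X_3&A_2\\-{}^tC_1&-{}^tB_2&-{}^tA_2&X_4\end{pmatrix},$$ with $X_i\in so(r_i)$ and the other blocks arbitrary real matrices of the appropriate sizes. With $\mathbb{Z}_2\times\mathbb{Z}_2=\{e,a,b,c\}$, $\mathfrak{g}_e$ is the subspace of block diagonal matrices (the Lie algebra of $H=SO(r_1)\times SO(r_2)\times SO(r_3)\times SO(r_4)$), and $\mathfrak{g}_a$, $\mathfrak{g}_b$, $\mathfrak{g}_c$ are the subspaces where only the blocks $A_1,A_2$, resp. $B_1,B_2$, resp. $C_1,C_2$ (and their negative transposes) are nonzero. This is a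 $(\mathbb{Z}_2\times\mathbb{Z}_2)$-grading. The associated automorphisms $\tau_\gamma$ of $so(2l+1)$, induced by automorphisms $\rho_\gamma$ of $SO(2l+1)$, are $\tau_e=\mathrm{id}$ and, for $\gamma\in\{a,b,c\}$, $\tau_\gamma=\mathrm{id}$ on $\mathfrak{g}_e\oplus\mathfrak{g}_\gamma$ and $-\mathrm{id}$ on the other two components. They define the $(\mathbb{Z}_2\times\mathbb{Z}_2)$-symmetric structure on $M=SO(2l+1)/H$. The elementary matrices (entry $1$ at one position $(i,j)$ of an upper block, $-1$ at $(j,i)$, $0$ elsewhere) of the blocks $A_1,A_2,B_1,B_2,C_1,C_2$ form a basis of $\mathfrak{m}$; the dual basis is $\{\alpha^1_{ij},\alpha^2_{ij},\beta^1_{ij},\beta^2_{ij},\gamma^1_{ij},\gamma^2_{ij}\}$ ($\alpha^1$ for $A_1$, etc.), and each sum runs over all index pairs of the corresponding block. Sums of squares denote quadratic forms. An invariant metric $g$ on $M$ is given by the $\mathrm{Ad}(H)$-invariant inner product $B$ on $\mathfrak{m}\cong T_{\bar e}M$ which is its value at $\bar e=H$. Symmetries: $s_{(\gamma,\bar e)}(\bar x)=\overline{\rho_\gamma(x)}$, and $s_{(\gamma,\overline{g_0})}(y)=g_0\,s_{(\gamma,\bar e)}(g_0^{-1}y)$. The canonical connection $\nabla$ is the invariant connection on $M$ with torsion $T(X,Y)_{\bar e}=-[X,Y]_{\mathfrak{m}}$ and curvature $R(X,Y)_{\bar e}Z=-[[X,Y]_{\mathfrak{g}_e},Z]$ for $X,Y,Z\in\mathfrak{m}$;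 the canonical torsion-free connection is $\overline\nabla=\nabla-\tfrac12T$, the invariant torsion-free connection having the same geodesics as $\nabla$. The metric $g$ is adapted to the $(\mathbb{Z}_2\times\mathbb{Z}_2)$-symmetric structure if all the symmetries $s_{(\gamma,x)}$ are isometries of $g$ and the Levi-Civita connection of $g$ coincides with $\overline\nabla$. *)

(* Defs.v *)
From HB Require Import structures.
From mathcomp Require Import all_boot all_order all_algebra.
From mathcomp Require Import all_classical all_reals all_analysis.
Set Implicit Arguments.
Unset Strict Implicit.
Unset Printing Implicit Defensive.
Import Order.TTheory GRing.Theory Num.Theory.
Import numFieldNormedType.Exports.
Local Open Scope classical_set_scope.
Local Open Scope ring_scope.

Notation V4 := ('Z_2 * 'Z_2)%type.
Definition Va : V4 := (1, 0).
Definition Vb : V4 := (0, 1).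
Definition Vc : V4 := (1, 1).

Section Groups.
Variable R : realType.

Definition SO k : set 'M[R]_k := [set x | x^T *m x = 1%:M /\ \det x = 1].
Definition so k : set 'M[R]_k := [set X | X^T = - X].
Definition brk k (X Y : 'M[R]_k) : 'M[R]_k := X *m Y - Y *m X.

End Groups.
Arguments SO {R k}.
Arguments so {R k}.

(* C^infinity maps: all iterated directional derivatives are (Frechet)
   differentiable everywhere. *)
Fixpoint smooth_upto (R : realType) (V W : normedModType R) (k : nat)
    (f : V -> W) : Prop :=
  if k is k'.+1 then
    (forall x, differentiable f x) /\ forall v, smooth_upto k' ('D_v f)
  else True.
Definition smooth (R : realType) (V W : normedModType R) (f : V -> W) :=
  forall k, smooth_upto k f.

Section Homogeneous.
Variables (R : realType) (r : 'I_4 -> nat).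

Local Notation mat := 'M[R]_(\sum_i r i).
Local Notation G := (@SO R (\sum_i r i)).

Definition H : set mat :=
  [set x | (forall i, SO (submxblock x i i)) /\
           (forall i j, i != j -> submxblock x i j = 0)].

(* Blocks are numbered from 0.  Block (i, j) has degree lab i + lab j in
   Z_2 x Z_2: e on the diagonal, a for {0,1} and {2,3} (A1, A2), b for {0,2}
   and {1,3} (B1, B2), c for {0,3} and {1,2} (C1, C2). *)
Definition lab (i : 'I_4) : V4 := [:: 0; Va; Vb; Vc]`_i.
Definition deg (i j : 'I_4) : V4 := lab i + lab j.

Definition grade (d : V4) : set mat :=
  [set X | so X /\ forall i j, deg i j != d -> submxblock X i j = 0].

Definition proj (d : V4) (X : mat) : mat :=
  \mxblock_(i, j) (if deg i j == d then submxblock X i j else 0).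

Definition m : set mat :=
  [set X | exists Xa Xb Xc,
     [/\ grade Va Xa, grade Vb Xb, grade Vc Xc & X = Xa + Xb + Xc]].

Definition projm (X : mat) : mat := proj Va X + proj Vb X + proj Vc X.

Definition tau (d : V4) (X : mat) : mat :=
  if d == 0 then X
  else \sum_(d' : V4) (if (d' == 0) || (d' == d) then proj d' X
                       else - proj d' X).

(* rho d is conjugation by the block scalar matrix S with entries 1, -1 (which
   is its own inverse); rho_tau below says that it induces tau d. *)
Definition sgn (d : V4) (i : 'I_4) : R :=
  if [|| d == 0, deg 0 i == 0 | deg 0 i == d] then 1 else - 1.
Definition Smx (d : V4) : mat := \mxdiag_i (sgn d i)%:M.
Definition rho (d : V4) (x : mat) : mat := Smx d *m x *m Smx d.

(* The tangent bundle of M = G/H is G x_H m: for x in G and X in m, the pair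
   (x, X) stands for the tangent vector at xH which is the image of the
   vector x *m X tangent to G at x.  For h in H, the pairs (x h, X) and
   (x, h X h^-1) stand for the same vector. *)

(* g x X Y is the inner product of the tangent vectors (x, X) and (x, Y); the
   values for x outside of G or X, Y outside of m are irrelevant.  The last
   clause is invariance under G; it implies smoothness in x. *)
Definition invariant_metric (g : mat -> mat -> mat -> R) : Prop :=
  [/\ forall x, G x ->
        [/\ forall s X Y Z, m X -> m Y -> m Z ->
              g x (s *: X + Y) Z = s * g x X Z + g x Y Z,
            forall X Y, m X -> m Y -> g x X Y = g x Y X
          & forall X, m X -> X != 0 -> 0 < g x X X],
      forall x h X Y, G x -> H h -> m X -> m Y ->
        g (x *m h) X Y = g x (h *m X *m h^T) (h *m Y *m h^T)
    & forall k x X Y, G k -> G x -> m X -> m Y -> g (k *m x) X Y = g x X Y].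

(* The symmetry s_(d, x0 H), as a map on representatives. *)
Definition symm (d : V4) (x0 x : mat) : mat := x0 *m rho d (x0^T *m x).

(* The differential of the map xH |-> phi(x) H of M, on the vector (x, X). *)
Definition tangent_map (phi : mat -> mat) (x X : mat) : mat :=
  projm ((phi x)^T *m 'D_(x *m X) phi x).

Definition isometric (g : mat -> mat -> mat -> R) (phi : mat -> mat) : Prop :=
  forall x X Y, G x -> m X -> m Y ->
    g (phi x) (tangent_map phi x X) (tangent_map phi x Y) = g x X Y.

(* A vector field on M: the H-equivariant map X from G to m, here extended
   smoothly to all matrices, encodes the field xH |-> (x, X x). *)
Definition vector_field (X : mat -> mat) : Prop :=
  [/\ smooth X, forall x, G x -> m (X x)
    & forall x h, G x -> H h -> X (x *m h) = h^T *m X x *m h].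

(* The horizontal vector field on G that projects to X. *)
Definition lift (X : mat -> mat) (x : mat) : mat := x *m X x.

Definition lie_bracket (X Y : mat -> mat) (x : mat) : mat :=
  projm (x^T *m ('D_(lift X x) (lift Y) x - 'D_(lift Y x) (lift X) x)).

(* The canonical connection of the reductive decomposition so = grade 0 + m:
   differentiation of the equivariant functions representing vector fields
   along horizontal lifts, so that parallel translation along the projection of
   x exp(tX) is left translation.  (For x in G the derivative belongs to m
   already.)  Its torsion at x is - [X, Y]_m, see torsion_nabla below, and its
   curvature R(X, Y)Z is - [[X, Y]_e, Z], where [X, Y]_e is the component of
   degree e. *)
Definition nabla (X Y : mat -> mat) (x : mat) : mat :=
  projm ('D_(lift X x) Y x).

Definition canonical_torsion (X Y : mat -> mat) (x : mat) : mat :=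
  - projm (brk (X x) (Y x)).

Definition nabla_bar (X Y : mat -> mat) (x : mat) : mat :=
  nabla X Y x - 2^-1 *: canonical_torsion X Y x.

Definition torsion (D : (mat -> mat) -> (mat -> mat) -> mat -> mat)
    (X Y : mat -> mat) (x : mat) : mat :=
  D X Y x - D Y X x - lie_bracket X Y x.

(* The affine connection D is the Levi-Civita connection of g: it is
   torsion-free and makes g parallel.  The derivative of the function g(Y, Z)
   along X is taken on any smooth extension F of this function from G to all
   matrices. *)
Definition levi_civita (g : mat -> mat -> mat -> R)
    (D : (mat -> mat) -> (mat -> mat) -> mat -> mat) : Prop :=
  (forall X Y, vector_field X -> vector_field Y ->
     forall x, G x -> torsion D X Y x = 0) /\
  (forall X Y Z, vector_field X -> vector_field Y -> vector_field Z ->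
     forall F : mat -> R, smooth F ->
     (forall y, G y -> F y = g y (Y y) (Z y)) ->
     forall x, G x ->
       'D_(lift X x) F x = g x (D X Y x) (Z x) + g x (Y x) (D X Z x)).

Definition adapted (g : mat -> mat -> mat -> R) : Prop :=
  (forall d x0, G x0 -> isometric g (symm d x0)) /\ levi_civita g nabla_bar.

End Homogeneous.
Arguments H {R r}.
Arguments grade {R r}.
Arguments m {R r}.

(* The sum of the squares of the coordinate forms of a block. *)
Definition sumsq (R : realType) p q (A : 'M[R]_(p, q)) : R :=
  \sum_i \sum_j (A i j) ^+ 2.

Section Facts.
Variables (R : realType) (r : 'I_4 -> nat).
Local Notation mat := 'M[R]_(\sum_i r i).

Lemma deg_eq0 (i j : 'I_4) : (deg i j == 0) = (i == j).
Proof. by move: i j; do 2 (case=> -[|[|[|[|?]]]] ? //). Qed.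

Lemma submxblock_proj d (X : mat) i j :
  submxblock (proj d X) i j = if deg i j == d then submxblock X i j else 0.
Proof. by rewrite mxblockK. Qed.

Lemma submxblock_rho d (x : mat) i j :
  submxblock (rho d x) i j = (sgn R d i * sgn R d j) *: submxblock x i j.
Proof.
rewrite /rho /Smx -{1}[x]submxblockK mul_mxdiag_mxblock mul_mxblock_mxdiag.
by rewrite mxblockK mul_mx_scalar mul_scalar_mx scalerA mulrC.
Qed.

Lemma rho_tau d (X : mat) : rho d X = tau d X.
Proof.
rewrite -[LHS]submxblockK -[RHS]submxblockK.
apply/eq_mxblock => i j; rewrite submxblock_rho /tau.
case: eqVneq => [->|dN0]; first by rewrite /sgn eqxx mulr1 scale1r.
have subN (A : mat) : submxblock (- A) i j = - submxblock A i j.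
  by apply/matrixP => p q; rewrite !mxE.
rewrite submxblock_sum (bigD1 (deg i j)) //= [X in _ + X]big1 ?addr0; last first.
  move=> d' d'N; case: ifP => _; rewrite ?subN submxblock_proj;
    by rewrite eq_sym (negbTE d'N) ?oppr0.
transitivity ((if (deg i j == 0) || (deg i j == d) then 1 else - 1)
   *: submxblock X i j); last first.
  by case: ifP => _; rewrite ?subN submxblock_proj eqxx ?scale1r // scaleN1r.
congr (_ *: _); rewrite /sgn (negbTE dN0) /=.
set u := _ || _; set v := _ || _; set w := _ || _.
have -> : w = (u == v); last first. by case: u; case: v; rewrite /= ?mul1r ?mulrNN ?mul1r ?mulr1.
rewrite {}/u {}/v {}/w; clear subN; move: dN0 i j; case: d => [[[|[|?]] ?] [[|[|?]] ?]] //;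
by move=> _; do 2 (case=> -[|[|[|[|?]]]] ? //).
Qed.

Lemma SO_rho d (x : mat) : SO x -> SO (rho d x).
Proof.
have SS : Smx R r d *m Smx R r d = 1%:M.
  rewrite -{1}[Smx R r d]mulmx1 -[LHS]/(rho d 1%:M).
  rewrite -[LHS]submxblockK -[RHS]submxblockK.
  apply/eq_mxblock => i j; rewrite submxblock_rho.
  have [<-|ij] := eqVneq i j.
    by rewrite /sgn; case: ifP; rewrite ?mulrNN mulr1 scale1r.
  suff -> : submxblock (1%:M : mat) i j = 0 by rewrite scaler0.
  rewrite -(mxdiagZ (p_ := r) (1 : R)) /mxdiag mxblockK.
  by rewrite (negbTE ij).
have ST : (Smx R r d)^T = Smx R r d.
  by rewrite /Smx tr_mxdiag; apply/eq_mxdiag => i; rewrite tr_scalar_mx.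
move=> [xx dx]; split.
  rewrite /rho !trmx_mul ST !mulmxA.
  rewrite -[X in X *m x *m _]mulmxA SS mulmx1.
  by rewrite -[X in X *m Smx R r d]mulmxA xx mulmx1 SS.
by rewrite /rho !det_mulmx dx mulr1 -det_mulmx SS det1.
Qed.

Lemma projmD (X Y : mat) : projm (X + Y) = projm X + projm Y.
Proof.
have projD d (A B : mat) : proj d (A + B) = proj d A + proj d B.
  rewrite /proj -mxblockD; apply/eq_mxblock => i j; case: ifP; rewrite ?addr0 //.
  by move=> _; apply/matrixP => p q; rewrite !mxE.
by rewrite /projm !projD [RHS]addrACA; congr (_ + _); rewrite [RHS]addrACA.
Qed.

Lemma projmN (X : mat) : projm (- X) = - projm X.
Proof.
have projN d (A : mat) : proj d (- A) = - proj d A.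
  rewrite /proj -mxblockN; apply/eq_mxblock => i j; case: ifP; rewrite ?oppr0 //.
  by move=> _; apply/matrixP => p q; rewrite !mxE.
by rewrite /projm !projN !opprD.
Qed.

Lemma derive_lift (X : mat -> mat) (x v : mat) : derivable X x v ->
  'D_v (lift X) x = v *m X x + x *m 'D_v X x.
Proof.
move=> dX; have dXij := (derivable_mxP X x v).1 dX.
have did (p q : 'I_(\sum_i r i)) : is_derive x v (fun y : mat => y p q) (v p q).
  have dI : derivable (@id mat) x v by exact: derivable_id.
  apply: DeriveDef; first exact: (derivable_mxP _ _ _).1 dI p q.
  have := derive_mx dI; rewrite derive_id => /matrixP /(_ p q).
  by rewrite mxE => ->.
have D p q : is_derive x v (fun y => lift X y p q)
    ((v *m X x + x *m 'D_v X x) p q).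
  rewrite (_ : (fun y => _) = \sum_k (fun y : mat => y p k * X y k q)); last first.
    by apply/funext => y; rewrite /lift mxE fct_sumE.
  rewrite !mxE -big_split /=.
  apply: is_derive_eq; first apply: is_derive_sum => k.
    apply: is_deriveM; apply/derivableP; exact: dXij.
  apply: eq_bigr => k _; rewrite derive_mx // !mxE addrC; congr (_ + _).
  by rewrite /GRing.scale /= mulrC.
rewrite derive_mx; first by apply/matrixP => p q; rewrite mxE; exact: derive_val.
by apply/derivable_mxP => p q; exact: ex_derive.
Qed.

Lemma torsion_nabla (X Y : mat -> mat) (x : mat) :
  vector_field X -> vector_field Y -> SO x ->
  torsion (@nabla R r) X Y x = canonical_torsion X Y x.
Proof.
move=> [sX _ _] [sY _ _] [xx _].
have dX v : derivable X x v by apply: diff_derivable; exact: (sX 1%N).1.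
have dY v : derivable Y x v by apply: diff_derivable; exact: (sY 1%N).1.
rewrite /torsion /nabla /lie_bracket /canonical_torsion !derive_lift //.
rewrite -!projmN -!projmD -?projmN; congr projm; rewrite /brk /lift.
rewrite mulmxBr !mulmxDr !mulmxA xx !mul1mx.
have aux (V : zmodType) (a b P Q : V) : a - b - (P + a - (Q + b)) = - (P - Q).
  apply/eqP; rewrite subr_eq opprB; apply/eqP.
  by rewrite addrA [_ + (P + a)]addrA subrK opprD addrA [Q + a]addrC addrK.
exact: aux.
Qed.

Lemma torsion_nabla_bar (X Y : mat -> mat) (x : mat) :
  vector_field X -> vector_field Y -> SO x ->
  torsion (@nabla_bar R r) X Y x = 0.
Proof.
move=> vX vY Gx; have := torsion_nabla vX vY Gx.
have sk : canonical_torsion Y X x = - canonical_torsion X Y x.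
  by rewrite /canonical_torsion -!projmN /brk !opprB.
rewrite /torsion /nabla_bar sk.
move: (canonical_torsion X Y x) => c E; rewrite scalerN opprK.
have aux (V : zmodType) (a b e u : V) : a - u - (b + u) - e = a - b - e - (u + u).
  by rewrite !opprD ![in LHS]addrA [RHS]addrA [a - u - b]addrAC ![_ - e]addrAC.
by rewrite aux E -scalerDl -div1r -splitr scale1r subrr.
Qed.

End Facts.

(* Main.v *)
Require Import Defs.
From mathcomp Require Import all_boot all_order all_algebra.
From mathcomp Require Import all_classical all_reals all_analysis.
From mathcomp Require Import ring zify.
Import Order.TTheory GRing.Theory Num.Theory.
Import numFieldNormedType.Exports.
Local Open Scope ring_scope.

(* Vector fields on M induced by the left action of SO(n), X_A(x) = (x^T A x)_m,
   and a smooth bilinear extension of g turn the condition that the Levi-Civita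
   connection be nabla_bar into natural reductivity at the base point:
   B([A, B']_m, C) + B(B', [A, C]_m) = 0 on m.  Let E_pq denote the elementary
   skew matrices and take p, s in different blocks.  Choosing q in a third
   block and writing E_ps = [E_pq, E_qs], natural reductivity gives
   B(E_ps, E_uv) = - B(E_qs, [E_pq, E_uv]_m).  This relates B(E_ps, E_ps) to
   B(E_qs, E_qs), hence all norms are equal, and it makes distinct E's
   orthogonal, except possibly when p, s, u, v are the only indices; that case
   is excluded because n = 2l+1 is odd. *)

Set Implicit Arguments.
Unset Strict Implicit.
Unset Printing Implicit Defensive.

(** * Closure properties of smooth maps *)

Section Smooth.
Variables (R : realType) (V : normedModType R).

(** This serves the product rule, where each summand keeps one factor that is not differentiated. *)
Lemma smooth_upto_pred (W : normedModType R) k (f : V -> W) :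
  smooth_upto k.+1 f -> smooth_upto k f.
Proof.
elim: k f => [//|k IH] f [df sf]; split=> // v.
exact: IH (sf v).
Qed.

Lemma smooth_cst (W : normedModType R) (w : W) : smooth (fun _ : V => w).
Proof.
move=> k; elim: k w => [//|k IH] w; split=> [x|v].
  exact: differentiable_cst.
rewrite (_ : 'D_v _ = fun=> 0); first exact: IH.
by apply/funext => x; exact: derive_cst.
Qed.

Lemma smooth_upto_add (W : normedModType R) k (f g : V -> W) :
  smooth_upto k f -> smooth_upto k g -> smooth_upto k (f + g).
Proof.
elim: k f g => [//|k IH] f g [df sf] [dg sg]; split=> [x|v].
  exact: differentiableD.
rewrite (_ : 'D_v _ = 'D_v f + 'D_v g); first by apply: IH; [exact: sf|exact: sg].
by apply/funext => x; apply: deriveD; exact: diff_derivable.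
Qed.

Lemma smooth_upto_mul k (f g : V -> R) :
  smooth_upto k f -> smooth_upto k g -> smooth_upto k (f * g).
Proof.
elim: k f g => [//|k IH] f g sf sg; split=> [x|v].
  by apply: differentiableM; [exact: sf.1|exact: sg.1].
rewrite (_ : 'D_v _ = f * 'D_v g + g * 'D_v f); last first.
  apply/funext => x; rewrite deriveM //; apply: diff_derivable.
    exact: sf.1.
  exact: sg.1.
apply: smooth_upto_add; apply: IH;
  by [exact: smooth_upto_pred | exact: sf.2 | exact: sg.2].
Qed.

Lemma smooth_upto_scalel (W : normedModType R) (w : W) k (f : V -> R) :
  smooth_upto k f -> smooth_upto k (fun x => f x *: w).
Proof.
elim: k f => [//|k IH] f [df sf]; split=> [x|v].
  exact: differentiableZl.
rewrite (_ : 'D_v _ = fun x => 'D_v f x *: w); first by apply: IH; exact: sf.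
apply/funext => x; rewrite !deriveE ?diffZl //.
exact: differentiableZl.
Qed.

Lemma smooth_add (W : normedModType R) (f g : V -> W) :
  smooth f -> smooth g -> smooth (fun x => f x + g x).
Proof. by move=> sf sg k; exact: smooth_upto_add. Qed.

Lemma smooth_mul (f g : V -> R) :
  smooth f -> smooth g -> smooth (fun x => f x * g x).
Proof. by move=> sf sg k; exact: smooth_upto_mul. Qed.

Lemma smooth_sum (W : normedModType R) (I : Type) (s : seq I) (f : I -> V -> W) :
  (forall i, smooth (f i)) -> smooth (fun x => \sum_(i <- s) f i x).
Proof.
move=> sf; elim: s => [|i s IH].
  under eq_fun do rewrite big_nil; exact: smooth_cst.
under eq_fun do rewrite big_cons; exact: smooth_add.
Qed.

Lemma smooth_mx p q (M : V -> 'M[R]_(p, q)) :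
  (forall i j, smooth (fun x => M x i j)) -> smooth M.
Proof.
move=> sM; rewrite (_ : M = fun x => \sum_i \sum_j M x i j *: delta_mx i j).
  apply: smooth_sum => i; apply: smooth_sum => j k.
  by apply: smooth_upto_scalel; exact: sM.
by apply/funext => x; exact: matrix_sum_delta.
Qed.

End Smooth.

(** * Derivatives of matrix-valued maps, computed entrywise *)

Section MatrixCalculus.
Variable R : realType.

Lemma is_derive_mxP (V : normedModType R) p q (M : V -> 'M[R]_(p, q)) x v dM :
  is_derive x v M dM <-> forall i j, is_derive x v (fun y => M y i j) (dM i j).
Proof.
split=> [DM i j|DM].
  have dMx : derivable M x v by exact: ex_derive.
  apply: DeriveDef; first exact: (derivable_mxP _ _ _).1 dMx i j.
  by have := derive_mx dMx; rewrite derive_val => ->; rewrite mxE.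
have dMx : derivable M x v.
  by apply/derivable_mxP => i j; exact: (@ex_derive _ _ _ _ _ _ _ (DM i j)).
apply: DeriveDef => //; rewrite derive_mx //; apply/matrixP => i j.
by rewrite mxE; have := DM i j => Dij; exact: derive_val.
Qed.

Lemma is_derive_mulmx (V : normedModType R) p q s (M : V -> 'M[R]_(p, q))
    (N : V -> 'M[R]_(q, s)) x v dM dN :
  is_derive x v M dM -> is_derive x v N dN ->
  is_derive x v (fun y => M y *m N y) (dM *m N x + M x *m dN).
Proof.
move=> /is_derive_mxP DM /is_derive_mxP DN; apply/is_derive_mxP => i j.
rewrite (_ : (fun y => _) = \sum_k ((fun y => M y i k) * (fun y => N y k j))).
  rewrite !mxE -big_split /=; apply: is_derive_eq.
  apply: eq_bigr => k _; rewrite addrC; congr (_ + _).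
  by rewrite /GRing.scale /= mulrC.
by apply/funext => y; rewrite mxE fct_sumE.
Qed.

Lemma smooth_coord p q (i : 'I_p) (j : 'I_q) :
  smooth (fun x : 'M[R]_(p, q) => x i j).
Proof.
case=> [//|k]; split=> [x|v]; first exact: differentiable_coord.
rewrite (_ : 'D_v _ = fun=> v i j); first exact: smooth_cst.
apply/funext => x.
by have /is_derive_mxP/(_ i j) D := is_derive_id x v; exact: derive_val.
Qed.

End MatrixCalculus.

(** * Combinatorics of an invariant form on elementary matrices; [f p s u v] stands for B(E_ps,
    E_uv) *)

Section BlockForms.
Variables (R : comNzRingType) (I : finType) (blk : I -> 'I_4).
Variable f : I -> I -> I -> I -> R.
Hypothesis fC : forall p s u v, f p s u v = f u v p s.
Hypothesis f_anti : forall p s u v, f p s u v = - f s p u v.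
Hypothesis f_same : forall p s u v, blk p = blk s -> f p s u v = 0.
(* ad (E_pq) is skew, evaluated on E_qs and E_uv; E_ps is [E_pq, E_qs]. *)
Hypothesis f_nat : forall p q s u v,
  blk p != blk q -> blk q != blk s -> blk p != blk s -> blk u != blk v ->
  f p s u v = - ((q == u)%:R * f q s p v - (q == v)%:R * f q s p u
                 - (p == u)%:R * f q s q v + (p == v)%:R * f q s q u).
Variables i0 i1 i2 : I.
Hypothesis blk_i0 : blk i0 = 0.
Hypothesis blk_i1 : blk i1 = 1.
Hypothesis blk_i2 : blk i2 = 2.
Hypothesis card_I : #|I| != 4%N.

Let neq_blk p q : blk p != blk q -> (p == q) = false.
Proof. by apply: contra_neqF => /eqP ->. Qed.

(** Two blocks cannot cover the blocks 0, 1, 2. These are the blocks known to be nonempty, and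
    taking the witness from a fixed list lets [block_form_diag] end at a fixed pair. *)
Lemma third_block (a b : 'I_4) :
  exists2 q, q \in [:: i0; i1; i2] & (blk q != a) && (blk q != b).
Proof.
have [/andP h|h0] := boolP ((0 != a) && (0 != b)).
  by exists i0; rewrite ?inE ?eqxx // blk_i0; apply/andP.
have [/andP h|h1] := boolP ((1 != a) && (1 != b)).
  by exists i1; rewrite ?inE ?eqxx ?orbT // blk_i1; apply/andP.
exists i2; first by rewrite !inE eqxx !orbT.
rewrite blk_i2; move: h0 h1; clear.
by move: a b; do 2 (case=> -[|[|[|[|?]]]] ? //).
Qed.

Lemma block_form_antir p s u v : f p s u v = - f p s v u.
Proof. by rewrite fC f_anti fC. Qed.

Lemma block_form_disjoint p q s u v :
  blk p != blk s -> blk u != blk v -> blk p != blk q -> blk q != blk s ->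
  q != u -> q != v -> p != u -> p != v -> f p s u v = 0.
Proof.
move=> ps uv pq qs /negbTE qu /negbTE qv /negbTE pu /negbTE pv.
rewrite (f_nat pq qs ps uv) qu qv pu pv /=; ring.
Qed.

(** This is [f_nat] with pivot q = v: only the term with coefficient [v == v] survives. *)
Lemma block_form_shift p s u v :
  blk p != blk s -> blk u != blk v -> blk v != blk p -> blk v != blk s ->
  f p s u v = f v s p u.
Proof.
move=> ps uv vp vs; have pv : blk p != blk v by rewrite eq_sym.
have vu : blk v != blk u by rewrite eq_sym.
have vv : f v s v v = 0 by rewrite fC f_same.
rewrite (f_nat pv vs ps uv) (neq_blk vu) eqxx (neq_blk pv) vv /=; ring.
Qed.

(** The cardinality hypothesis enters here, through a fifth index used as pivot. On so(4) the
    polarized Pfaffian is ad-invariant and pairs E_ps with E_uv, so four indices in all must be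
    excluded. *)
Lemma block_form_distinct_blocks p s u v :
  blk p != blk s -> blk p != blk u -> blk p != blk v ->
  blk s != blk u -> blk s != blk v -> blk u != blk v -> f p s u v = 0.
Proof.
move=> ps pu pv su sv uv.
have [q] : exists q, q \notin [:: p; s; u; v].
  apply/existsP; rewrite -negb_forall; apply: contra card_I => /forallP all4.
  have U : uniq [:: p; s; u; v].
    by rewrite /= !inE !(neq_blk ps, neq_blk pu, neq_blk pv, neq_blk su,
      neq_blk sv, neq_blk uv).
  have <- : #|[:: p; s; u; v]| = 4%N := card_uniqP U.
  by rewrite eqn_leq max_card andbT; apply/subset_leq_card/fintype.subsetP.
rewrite !inE !negb_or => /and4P[qp qs qu qv].
(* If q lies outside the blocks of p and s, it is a pivot for E_ps. Otherwise it lies outside those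
   of u and v, and by symmetry of the form it is a pivot for E_uv. *)
have [qps|] := boolP ((blk q != blk p) && (blk q != blk s)).
  case/andP: qps => bqp bqs; apply: (@block_form_disjoint _ q) => //.
  - by rewrite eq_sym.
  - by rewrite neq_blk.
  - by rewrite neq_blk.
move=> qps; rewrite fC; apply: (@block_form_disjoint _ q) => //.
- apply: contraNN qps => /eqP <-.
  by rewrite (eq_sym (blk u)) pu (eq_sym _ (blk s)) su.
- by apply: contraNN qps => /eqP ->; rewrite !(eq_sym (blk v)) pv sv.
- by rewrite eq_sym neq_blk.
- by rewrite eq_sym neq_blk.
Qed.

(** If u shares a block with p or s, a shift produces an elementary matrix inside a diagonal block,
    which counts as zero. Otherwise the four blocks are distinct. *)
Let f_in_third p s u v : blk p != blk s -> blk u != blk v ->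
  blk v != blk p -> blk v != blk s -> f p s u v = 0.
Proof.
move=> ps uv vp vs.
have [up|up] := eqVneq (blk u) (blk p).
  by rewrite block_form_shift // fC f_same.
have [us|us] := eqVneq (blk u) (blk s).
  by rewrite f_anti block_form_shift // 1?eq_sym // fC f_same ?oppr0.
by apply: block_form_distinct_blocks; rewrite // eq_sym.
Qed.

Let f_orth_l p s u v : blk p != blk s -> blk u != blk v ->
  p != u -> p != v -> f p s u v = 0.
Proof.
move=> ps uv pu pv.
have [q _ /andP[qp qs]] := third_block (blk p) (blk s).
(* A pivot equal to v or u puts that index in a third block; any other pivot makes all four
   Kronecker deltas of [f_nat] vanish. *)
have [qv|qv] := eqVneq q v; first by apply: f_in_third; rewrite // -qv.
have [qu|qu] := eqVneq q u.
  by rewrite block_form_antir f_in_third ?oppr0 // -?qu // qu eq_sym.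
by apply: (@block_form_disjoint _ q); rewrite // eq_sym.
Qed.

Lemma block_form_orth p s u v : blk p != blk s -> blk u != blk v ->
  (p == u) && (s == v) = false -> (p == v) && (s == u) = false ->
  f p s u v = 0.
Proof.
move=> ps uv.
have sp : blk s != blk p by rewrite eq_sym.
(* If p is u or v, then s is neither, and E_ps = - E_sp exchanges their roles. *)
have [pu /= sv|pu _] := eqVneq p u.
  move=> _; rewrite f_anti f_orth_l ?oppr0 ?sv //.
  by rewrite -pu neq_blk.
have [pv /= su|pv _] := eqVneq p v.
  by rewrite f_anti f_orth_l ?oppr0 ?su // -pv neq_blk.
exact: f_orth_l.
Qed.

(** With u = p and v = s, only the [p == u] term of [f_nat] remains: an index may be moved to a
    third block without changing the norm. *)
Lemma block_form_diag_third p q s :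
  blk p != blk q -> blk q != blk s -> blk p != blk s ->
  f p s p s = f q s q s.
Proof.
move=> pq qs ps; rewrite (f_nat pq qs ps ps) eqxx.
by rewrite eq_sym !(neq_blk pq, neq_blk qs, neq_blk ps) /=; ring.
Qed.

Lemma block_form_diagC p s : f p s p s = f s p s p.
Proof. by rewrite f_anti block_form_antir opprK. Qed.

Lemma block_form_diag_row p q s :
  blk p != blk q -> blk q != blk s -> blk p != blk s ->
  f p s p s = f p q p q.
Proof.
move=> pq qs ps; rewrite block_form_diagC (block_form_diag_third (q := q));
rewrite 1?block_form_diagC //;
by rewrite eq_sym.
Qed.

Lemma block_form_diag p s : blk p != blk s -> f p s p s = f i0 i1 i0 i1.
Proof.
have tri : [/\ f i1 i2 i1 i2 = f i0 i1 i0 i1 & f i0 i2 i0 i2 = f i0 i1 i0 i1].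
  split; last by apply: block_form_diag_row; rewrite ?blk_i0 ?blk_i1 ?blk_i2.
  rewrite block_form_diagC block_form_diagC [RHS]block_form_diagC.
  by apply: block_form_diag_row; rewrite ?blk_i0 ?blk_i1 ?blk_i2.
have base : {in [:: i0; i1; i2] &, forall q q', blk q != blk q' ->
    f q q' q q' = f i0 i1 i0 i1}.
  case: tri => t12 t02 q q'; rewrite !inE.
  move=> /or3P[]/eqP-> /or3P[]/eqP->; rewrite ?eqxx // => _;
  by rewrite block_form_diagC.
move=> ps.
(* E_ps has the norm of E_pq, and then of E_q'q, where q and q' are both among [i0], [i1], [i2]. *)
have [q q3 /andP[qp qs]] := third_block (blk p) (blk s).
have [q' q'3 /andP[q'p q'q]] := third_block (blk p) (blk q).
rewrite (block_form_diag_row (q := q)) // 1?eq_sym //;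
rewrite 1?(block_form_diag_third (q := q')) //;
by rewrite ?base // eq_sym.
Qed.

(** The factor in parentheses is - tr(E_ps E_uv) / 2, so the form is a multiple of the trace
    form. *)
Lemma block_form_scalar p s u v : blk p != blk s -> blk u != blk v ->
  f p s u v = f i0 i1 i0 i1 *
    ((p == u)%:R * (s == v)%:R - (p == v)%:R * (s == u)%:R).
Proof.
move=> ps uv; rewrite -!natrM !mulnb.
have [/andP[/eqP <- /eqP <-]|ne] := boolP ((p == u) && (s == v)).
  by rewrite block_form_diag // (neq_blk ps) /= subr0 mulr1.
have [/andP[/eqP <- /eqP <-]|ne'] := boolP ((p == v) && (s == u)).
  by rewrite block_form_antir block_form_diag // sub0r mulrN1.
by rewrite block_form_orth ?subr0 ?mulr0 //; exact: negbTE.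
Qed.

End BlockForms.

(** * The projection onto m *)

Section Projection.
Variables (R : realType) (r : 'I_4 -> nat).
Local Notation mat := 'M[R]_(\sum_i r i).
Implicit Types (X Y Z : mat) (p q : 'I_(\sum_i r i)).

Local Notation blk := (@tagnat.sig1 4 r).

Lemma submxblock_projm X i j :
  submxblock (projm X) i j = if i == j then 0 else submxblock X i j.
Proof.
rewrite /projm !submxblockD !submxblock_proj.
move: i j; do 2 (case=> -[|[|[|[|?]]]] ? //); rewrite ?add0r ?addr0 //.
Qed.

Lemma projmE X p q : projm X p q = if blk p == blk q then 0 else X p q.
Proof.
have := congr1
  (fun A : 'M[R]_(r (blk p), r (blk q)) => A (tagnat.sig2 p) (tagnat.sig2 q))
  (submxblock_projm X (blk p) (blk q)).
by rewrite /= mxE !tagnat.sig2K => ->; case: ifP; rewrite mxE ?tagnat.sig2K.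
Qed.

Lemma projmZ (s : R) X : projm (s *: X) = s *: projm X.
Proof.
by apply/matrixP => p q; rewrite !(projmE, mxE); case: ifP; rewrite ?mulr0.
Qed.

Lemma projmK X : projm (projm X) = projm X.
Proof. by apply/matrixP => p q; rewrite !projmE; case: (blk p == _). Qed.

Lemma tr_projm X : (projm X)^T = projm X^T.
Proof. by apply/matrixP => p q; rewrite !(projmE, mxE) eq_sym. Qed.

Lemma m_projm X : so X -> m (projm X).
Proof.
move=> sX; exists (Defs.proj Va X), (Defs.proj Vb X), (Defs.proj Vc X).
have grade_proj d : grade d (Defs.proj d X).
  split=> [|i j /negbTE ij]; last by rewrite submxblock_proj ij.
  rewrite /so /= /Defs.proj tr_mxblock -mxblockN; apply/eq_mxblock => i j.
  rewrite /deg addrC; case: ifP => _; last by rewrite trmx0 oppr0.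
  by rewrite tr_submxblock sX submxblockN.
by split.
Qed.

Lemma so_m X : m X -> so X.
Proof.
move=> [Xa [Xb [Xc [[sa _] [sb _] [sc _] ->]]]].
by rewrite /so /= !linearD /= sa sb sc.
Qed.

Lemma projm_id X : m X -> projm X = X.
Proof.
move=> [Xa [Xb [Xc [[_ ba] [_ bb] [_ bc] ->]]]].
apply/mxblockP => i j; rewrite submxblock_projm.
case: eqVneq => // <-.
by rewrite !submxblockD ba ?bb ?bc ?addr0 //; move: i; case=> -[|[|[|[|?]]]] ?.
Qed.

Lemma m_so X : so X -> projm X = X -> m X.
Proof. by move=> sX <-; exact: m_projm. Qed.

(** As h is block diagonal, conjugation acts on each block separately. This yields the
    H-equivariance of the Killing fields. *)
Lemma projm_conj (h : mat) Z : H h -> projm (h^T *m Z *m h) = h^T *m projm Z *m h.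
Proof.
move=> [_ h0].
have {1 2 3 4}-> : h = \mxdiag_i submxblock h i i.
  apply/mxblockP => i j; rewrite /mxdiag mxblockK.
  case: eqVneq => [<-|ij]; first by rewrite conform_mx_id.
  exact: h0.
rewrite tr_mxdiag -[Z in LHS]submxblockK -[projm Z in RHS]submxblockK.
rewrite !mul_mxdiag_mxblock !mul_mxblock_mxdiag.
apply/mxblockP => i j; rewrite submxblock_projm !mxblockK submxblock_projm.
by case: eqVneq => // _; rewrite mulmx0 mul0mx.
Qed.

End Projection.

(** Linearity is assumed for a bare function, in the shape in which [invariant_metric] provides
    it. *)
Lemma linear_form_sum_delta (R : comNzRingType) p q (phi : 'M[R]_(p, q) -> R) :
  (forall s X Y, phi (s *: X + Y) = s * phi X + phi Y) ->
  forall X, phi X = \sum_i \sum_j X i j * phi (delta_mx i j).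
Proof.
move=> phiL X.
have phiD : {morph phi : A B / A + B}.
  by move=> A B; rewrite -{1}[A]scale1r phiL mul1r.
have phi0 : phi 0 = 0 by apply: (@addrI _ (phi 0)); rewrite -phiD !addr0.
rewrite {1}[X]matrix_sum_delta (big_morph _ phiD phi0); apply: eq_bigr => i _.
rewrite (big_morph _ phiD phi0); apply: eq_bigr => j _.
by rewrite -[_ *: _]addr0 phiL phi0 addr0.
Qed.

Lemma SO1 (R : realType) k : SO (1%:M : 'M[R]_k).
Proof. by split; rewrite ?trmx1 ?mul1mx ?det1. Qed.

(** * Killing fields and their covariant derivatives at the base point *)

Section KillingFields.
Variables (R : realType) (r : 'I_4 -> nat).
Local Notation mat := 'M[R]_(\sum_i r i).
Implicit Types (A B C X Y Z : mat).

(* The field on M generated by the left action of the one-parameter group of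
   A. *)
Definition killing A (x : mat) : mat := projm (x^T *m A *m x).

Lemma killing1 A : m A -> killing A 1%:M = A.
Proof. by move=> mA; rewrite /killing trmx1 mul1mx mulmx1 projm_id. Qed.

Lemma m_killing A x : so A -> m (killing A x).
Proof.
move=> sA; apply: m_projm.
by rewrite /so /= !trmx_mul trmxK sA mulNmx mulmxN mulmxA.
Qed.

Lemma smooth_killing A p q : smooth (fun x => killing A x p q).
Proof.
(* Each entry is zero or a quadratic polynomial in the entries of x. *)
rewrite (_ : (fun x => _) = if tagnat.sig1 p == tagnat.sig1 q then fun=> 0
    else fun x : mat => \sum_k (\sum_l x l p * A l k) * x k q); last first.
  apply/funext => x; rewrite projmE; case: (_ == _) => //.
  rewrite mxE; apply: eq_bigr => k _; rewrite mxE; congr (_ * _).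
  by apply: eq_bigr => l _; rewrite mxE.
case: ifP => _; first exact: smooth_cst.
apply: smooth_sum => k; apply: smooth_mul; last exact: smooth_coord.
apply: smooth_sum => l; apply: smooth_mul; [exact: smooth_coord|].
exact: smooth_cst.
Qed.

Lemma vector_field_killing A : so A -> vector_field (killing A).
Proof.
move=> sA; split=> [|x _|x h _ Hh]; first exact/smooth_mx/smooth_killing.
  exact: m_killing.
by rewrite /killing -projm_conj // trmx_mul !mulmxA.
Qed.

Lemma is_derive_killing A v :
  is_derive 1%:M v (killing A) (projm (v^T *m A + A *m v)).
Proof.
have Did : is_derive (1%:M : mat) v id v by exact: is_derive_id.
have Dtr : is_derive (1%:M : mat) v trmx v^T.
  apply/is_derive_mxP => p q; rewrite mxE.
  rewrite (_ : (fun y => _) = fun y : mat => y q p); last first.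
    by apply/funext => y; rewrite mxE.
  by have /is_derive_mxP := Did; apply.
have DA : is_derive (1%:M : mat) v (fun=> A) 0 by exact: is_derive_cst.
have /is_derive_mxP D := is_derive_mulmx (is_derive_mulmx Dtr DA) Did.
apply/is_derive_mxP => p q.
rewrite (_ : (fun y => _) = if tagnat.sig1 p == tagnat.sig1 q then fun=> 0
    else fun y : mat => (y^T *m A *m y) p q); last first.
  by apply/funext => y; rewrite projmE; case: (_ == _).
rewrite projmE; case: ifP => _; first exact: is_derive_cst.
have := D p q => /is_derive_eq; apply.
by rewrite mulmx0 addr0 mulmx1 trmx1 mul1mx.
Qed.

(** The derivative of [killing B] along A is - [A, B]_m, and the torsion correction adds half of
    [A, B]_m. *)
Lemma nabla_bar_killing A B : m A -> m B ->
  nabla_bar (killing A) (killing B) 1%:M = - 2^-1 *: projm (brk A B).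
Proof.
move=> mA mB; rewrite /nabla_bar /nabla /canonical_torsion /Defs.lift.
rewrite mul1mx !killing1 //.
have D := is_derive_killing B A; rewrite derive_val projmK (so_m mA).
rewrite (_ : - A *m B + B *m A = - brk A B); last by rewrite mulNmx /brk opprB addrC.
rewrite projmN scalerN opprK -scaleN1r -scalerDl; congr (_ *: _).
by rewrite {1}[1]splitr div1r opprD addrNK.
Qed.

End KillingFields.

(** * Natural reductivity of the metric *)

Section NaturalReductivity.
Variables (R : realType) (r : 'I_4 -> nat).
Local Notation mat := 'M[R]_(\sum_i r i).
Implicit Types (A B C X Y Z : mat).
Variable g : mat -> mat -> mat -> R.
Hypothesis hg : invariant_metric g.

(** The antisymmetrization is needed because [projm] alone does not make a matrix skew. *)
Definition mpart X : mat := 2^-1 *: projm (X - X^T).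

Lemma m_mpart X : m (mpart X).
Proof.
apply: m_so; last by rewrite projmZ projmK.
by rewrite /so /= linearZ /= tr_projm linearB /= trmxK -scalerN -projmN opprB.
Qed.

Lemma mpart_linear s X Y : mpart (s *: X + Y) = s *: mpart X + mpart Y.
Proof.
apply/matrixP => p q; rewrite !(projmE, mxE); case: (_ == _); ring.
Qed.

Lemma mpart_id X : m X -> mpart X = X.
Proof.
move=> mX; rewrite /mpart (so_m mX) opprK projmD projm_id // scalerDr -scalerDl.
by rewrite -div1r -splitr scale1r.
Qed.

(* g 1 is meaningful on m only; precomposing with a projection onto m yields a
   form that is bilinear on all matrices. *)
Definition mform X Y := g 1%:M (mpart X) (mpart Y).

Lemma mformC X Y : mform X Y = mform Y X.
Proof. by have [/(_ _ (SO1 _ _))[_ gC _] _ _] := hg; apply: gC; exact: m_mpart. Qed.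

Lemma mform_linear Z s X Y : mform (s *: X + Y) Z = s * mform X Z + mform Y Z.
Proof.
have [/(_ _ (SO1 _ _))[gL _ _] _ _] := hg.
by rewrite /mform mpart_linear gL //; exact: m_mpart.
Qed.

Lemma mform0 Z : mform 0 Z = 0.
Proof. by have := mform_linear Z (-1) 0 0; rewrite scaler0 addr0 mulN1r addNr. Qed.

Lemma mformZ Z s X : mform (s *: X) Z = s * mform X Z.
Proof. by rewrite -[s *: X]addr0 mform_linear mform0 addr0. Qed.

Lemma mformN Z X : mform (- X) Z = - mform X Z.
Proof. by rewrite -scaleN1r mformZ mulN1r. Qed.

Lemma mformE X Y : m X -> m Y -> mform X Y = g 1%:M X Y.
Proof. by move=> mX mY; rewrite /mform !mpart_id. Qed.

Lemma mform_sum X Y :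
  mform X Y = \sum_i \sum_j \sum_k \sum_l
    X i j * Y k l * mform (delta_mx i j) (delta_mx k l).
Proof.
rewrite (linear_form_sum_delta (mform_linear Y)).
apply: eq_bigr => i _; apply: eq_bigr => j _.
rewrite mformC (linear_form_sum_delta (mform_linear _)) mulr_sumr.
apply: eq_bigr => k _; rewrite mulr_sumr; apply: eq_bigr => l _.
by rewrite mulrA mformC.
Qed.

Lemma smooth_mform (V : normedModType R) (Y Z : V -> mat) :
  (forall p q, smooth (fun x => Y x p q)) ->
  (forall p q, smooth (fun x => Z x p q)) ->
  smooth (fun x => mform (Y x) (Z x)).
Proof.
move=> sY sZ; under eq_fun do rewrite mform_sum.
do 4 apply: smooth_sum => ?.
by apply: smooth_mul; [apply: smooth_mul|exact: smooth_cst].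
Qed.

Lemma is_derive_mform (V : normedModType R) (Y Z : V -> mat) x v dY dZ :
  is_derive x v Y dY -> is_derive x v Z dZ ->
  is_derive x v (fun x => mform (Y x) (Z x)) (mform dY (Z x) + mform (Y x) dZ).
Proof.
move=> /is_derive_mxP DY /is_derive_mxP DZ.
rewrite (_ : (fun x => _) = \sum_i \sum_j \sum_k \sum_l
  ((fun x => Y x i j) * (fun x => Z x k l) *
   cst (mform (delta_mx i j) (delta_mx k l)))); last first.
  apply/funext => y; rewrite mform_sum fct_sumE; apply: eq_bigr => i _.
  rewrite fct_sumE; apply: eq_bigr => j _; rewrite fct_sumE; apply: eq_bigr => k _.
  by rewrite fct_sumE.
apply: is_derive_eq.
rewrite !mform_sum; do 4 (rewrite -big_split /=; apply: eq_bigr => ? _).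
rewrite /GRing.scale /= /cst; ring.
Qed.

(** Metric compatibility is evaluated at the identity on the Killing fields of A, B, C. The
    derivative of g(K_B, K_C) is minus the sum in question, whereas the covariant derivatives
    contribute only minus half of it. *)
Lemma naturally_reductive A B C : levi_civita g (@nabla_bar R r) ->
  m A -> m B -> m C ->
  mform (projm (brk A B)) C + mform B (projm (brk A C)) = 0.
Proof.
move=> [_ parallel] mA mB mC.
have [_ _ ginv] := hg.
have K X : m X -> vector_field (killing X).
  by move=> mX; apply/vector_field_killing/so_m.
have := parallel _ _ _ (K _ mA) (K _ mB) (K _ mC)
  (fun y => mform (killing B y) (killing C y)).
have sm : smooth (fun y => mform (killing B y) (killing C y)).
  by apply: smooth_mform; exact: smooth_killing.
(* By left invariance, [mform], which is g at the identity, computes g at every point of SO; so this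
   function is an admissible smooth extension. *)
have kE y : SO y ->
    mform (killing B y) (killing C y) = g y (killing B y) (killing C y).
  move=> Gy; have [mB' mC'] : m (killing B y) /\ m (killing C y).
    by split; apply: m_killing; exact: so_m.
  by rewrite mformE // -(ginv y 1%:M) ?mulmx1 //; exact: SO1.
move=> /(_ sm kE _ (SO1 _ _)).
rewrite !nabla_bar_killing // !killing1 // /Defs.lift mul1mx killing1 //.
have D := is_derive_mform (is_derive_killing B A) (is_derive_killing C A).
rewrite derive_val !killing1 // (so_m mA) !mulNmx.
have brkN X : - (A *m X) + X *m A = - brk A X by rewrite /brk opprB addrC.
have mbrk X : m X -> m (projm (brk A X)).
  move=> mX; apply: m_projm; rewrite /so /= linearB /= !trmx_mul.
  by rewrite !(so_m mA, so_m mX) !mulmxN !mulNmx !opprK opprB.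
rewrite !brkN !projmN.
have mZ s X : m X -> m (s *: X).
  move=> mX; apply: m_so; first by rewrite /so /= linearZ /= (so_m mX) scalerN.
  by rewrite projmZ projm_id.
rewrite -!mformE //; try by [apply: mZ; exact: mbrk].
rewrite !(mformC B) !mformN !mformZ.
move: (mform _ C) (mform _ B) => u w E.
have /eqP : - 2^-1 * (u + w) = 0.
  by rewrite -(subrr (- u - w)) {2}E; field.
by rewrite mulf_eq0 oppr_eq0 invr_eq0 pnatr_eq0 => /eqP.
Qed.

End NaturalReductivity.

Lemma big_ord4 (T : Type) (idx : T) (op : Monoid.law idx) (F : 'I_4 -> T) :
  \big[op/idx]_(i < 4) F i = op (op (op (F 0) (F 1)) (F 2)) (F 3).
Proof.
rewrite !big_ord_recr big_ord0 /= Monoid.mul1m.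
by congr (op (op (op (F _) (F _)) (F _)) (F _)); exact: val_inj.
Qed.

(** * Elementary skew matrices and sums of squares over blocks *)

Section ElementaryMatrices.
Variables (R : realType) (r : 'I_4 -> nat).
Local Notation n := (\sum_i r i)%N.
Local Notation mat := 'M[R]_n.
Local Notation blk := (@tagnat.sig1 4 r).
Implicit Types (X Y : mat) (p q s u v : 'I_n).

(** The projection kills E_pq when p and q share a block, so bracket formulas in m need no case
    distinction on their terms. *)
Definition elem p q : mat := projm (delta_mx p q - delta_mx q p).

Lemma m_elem p q : m (elem p q).
Proof. by apply: m_projm; rewrite /so /= linearB /= !trmx_delta opprB. Qed.

Lemma elemN p q : elem p q = - elem q p.
Proof. by rewrite /elem -projmN opprB. Qed.

Lemma elem_same p q : blk p = blk q -> elem p q = 0.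
Proof.
move=> pq; apply/matrixP => i j; rewrite projmE !mxE.
case: eqVneq => // ij.
have [ip|_] := eqVneq i p; have [jq|_] := eqVneq j q => /=;
have [iq|_] := eqVneq i q; have [jp|_] := eqVneq j p => /=; rewrite ?subrr //;
by move: ij; subst; rewrite ?pq ?eqxx.
Qed.

Lemma elem_neq p q : blk p != blk q -> elem p q = delta_mx p q - delta_mx q p.
Proof.
move=> pq; apply/matrixP => i j; rewrite projmE !mxE.
case: eqVneq => // ij.
have [ip|_] := eqVneq i p; have [jq|_] := eqVneq j q => /=;
have [iq|_] := eqVneq i q; have [jp|_] := eqVneq j p => /=; rewrite ?subrr //;
by move: pq; subst; rewrite ?ij ?eqxx.
Qed.

(** These are the commutation relations of so(n), the terms of degree e being removed by [elem]. *)
Lemma projm_brk_elem p q u v : blk p != blk q -> blk u != blk v ->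
  projm (brk (elem p q) (elem u v)) =
    (q == u)%:R *: elem p v - (q == v)%:R *: elem p u
    - (p == u)%:R *: elem q v + (p == v)%:R *: elem q u.
Proof.
move=> pq uv; rewrite !(@elem_neq p q, @elem_neq u v) // /brk.
rewrite !(mulmxBl, mulmxBr) !mul_delta_mx_cond.
rewrite (eq_sym u p) (eq_sym u q) (eq_sym v p) (eq_sym v q).
by apply/matrixP => i j; rewrite !(projmE, mxE, mulmxnE); case: (_ == _); ring.
Qed.

Lemma sum_Rank (V : nmodType) (F : 'I_n -> V) :
  \sum_p F p = \sum_i \sum_(k < r i) F (tagnat.Rank i k).
Proof.
rewrite sig_big_dep /= (reindex _ tagnat.sig_bij_on) /=.
by apply: eq_bigr => p _; rewrite [tagnat.Rank _ _]tagnat.sig2K.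
Qed.

Lemma sumsq_blocks X :
  \sum_p \sum_q X p q ^+ 2 = \sum_i \sum_j sumsq (submxblock X i j).
Proof.
rewrite sum_Rank; apply: eq_bigr => i _.
rewrite /sumsq [RHS]exchange_big /=; apply: eq_bigr => k _.
rewrite sum_Rank; apply: eq_bigr => j _; apply: eq_bigr => l _.
by rewrite mxE.
Qed.

Lemma sumsq_tr (k l : nat) (A : 'M[R]_(k, l)) : sumsq A^T = sumsq A.
Proof.
rewrite /sumsq exchange_big; apply: eq_bigr => i _; apply: eq_bigr => j _.
by rewrite mxE.
Qed.

(** The diagonal blocks vanish, and each upper block reappears below the diagonal as its negative
    transpose; hence the factor 2. *)
Lemma sumsq_m X : m X ->
  \sum_p \sum_q X p q ^+ 2 =
    2 * (sumsq (submxblock X 0 1) + sumsq (submxblock X 2 3) +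
         sumsq (submxblock X 0 2) + sumsq (submxblock X 1 3) +
         sumsq (submxblock X 0 3) + sumsq (submxblock X 1 2)).
Proof.
move=> mX; rewrite sumsq_blocks.
have sq0 i : sumsq (submxblock X i i) = 0.
  rewrite -[X in submxblock X](projm_id mX) submxblock_projm eqxx.
  by rewrite /sumsq big1 // => k _; rewrite big1 // => l _; rewrite mxE expr0n.
have sqC i j : sumsq (submxblock X i j) = sumsq (submxblock X j i).
  rewrite -sumsq_tr tr_submxblock (so_m mX) submxblockN.
  rewrite /sumsq; apply: eq_bigr => k _; apply: eq_bigr => l _.
  by rewrite mxE sqrrN.
rewrite !big_ord4 /= !sq0 (sqC 1 0) (sqC 2 0) (sqC 3 0) (sqC 2 1) (sqC 3 1) (sqC 3 2).
ring.
Qed.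

Variable g : mat -> mat -> mat -> R.
Hypothesis hg : invariant_metric g.

Lemma mform_delta p q u v :
  mform g (delta_mx p q) (delta_mx u v) = 4^-1 * mform g (elem p q) (elem u v).
Proof.
(* Each argument contributes a factor 1/2, whence the 1/4. *)
have mpart_delta p' q' : mpart (delta_mx p' q') = 2^-1 *: elem p' q' :> mat.
  by rewrite /mpart trmx_delta.
have mpartK X Y : mform g (mpart X) (mpart Y) = mform g X Y.
  by rewrite /mform !(mpart_id (m_mpart _)).
rewrite -mpartK !mpart_delta (mformZ hg) (mformC hg) (mformZ hg) (mformC hg).
by move: (mform _ _ _) => x; field.
Qed.

(** Natural reductivity for E_pq, E_qs, E_uv, where [E_pq, E_qs] = E_ps as p, q, s lie in three
    blocks. It supplies the hypothesis [f_nat]. *)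
Lemma mform_elem_nat (hLC : levi_civita g (@nabla_bar R r)) p q s u v :
  blk p != blk q -> blk q != blk s -> blk p != blk s -> blk u != blk v ->
  mform g (elem p s) (elem u v) =
    - ((q == u)%:R * mform g (elem q s) (elem p v)
       - (q == v)%:R * mform g (elem q s) (elem p u)
       - (p == u)%:R * mform g (elem q s) (elem q v)
       + (p == v)%:R * mform g (elem q s) (elem q u)).
Proof.
move=> pq qs ps uv.
have neq a b : blk a != blk b -> (a == b) = false.
  by apply: contra_neqF => /eqP ->.
have mform_comb X A B C D (a b c d : R) :
    mform g X (a *: A - b *: B - c *: C + d *: D) =
    a * mform g X A - b * mform g X B - c * mform g X C + d * mform g X D.
  have -> : a *: A - b *: B - c *: C + d *: D =
      a *: A + ((- b) *: B + ((- c) *: C + (d *: D + 0))).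
    by rewrite addr0 !scaleNr !addrA.
  rewrite !(mformC hg X) !(mform_linear hg) (mform0 hg).
  move: (mform _ A X) (mform _ B X) (mform _ C X) (mform _ D X) => *; ring.
have := naturally_reductive hg hLC (m_elem p q) (m_elem q s) (m_elem u v).
rewrite (projm_brk_elem pq qs) (projm_brk_elem pq uv) mform_comb.
rewrite eqxx (neq _ _ pq) (neq _ _ qs) (neq _ _ ps).
rewrite !scale0r scale1r !subr0 addr0 => /eqP; rewrite addr_eq0 => /eqP ->.
by [].
Qed.

End ElementaryMatrices.

(** * Expansion of the metric in matrix entries *)

Unset Implicit Arguments.

Theorem proposition10 (R : realType) (l : nat) (r : 'I_4 -> nat)
    (hr1 : (1 <= r 0%R)%N) (hr2 : (1 <= r 1%R)%N) (hr3 : (1 <= r 2%R)%N)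
    (hsum : (r 0%R + r 1%R + r 2%R + r 3%R = 2 * l + 1)%N)
    (g : 'M[R]_(\sum_i r i) -> 'M[R]_(\sum_i r i) -> 'M[R]_(\sum_i r i) -> R)
    (hg : invariant_metric g) (hadapted : adapted g) :
  exists t : R, 0 < t /\
    forall X : 'M[R]_(\sum_i r i), m X ->
      g 1%:M X X =
        t * (sumsq (submxblock X 0 1) + sumsq (submxblock X 2 3) +
             sumsq (submxblock X 0 2) + sumsq (submxblock X 1 3) +
             sumsq (submxblock X 0 3) + sumsq (submxblock X 1 2)).
Proof.
have [_ hLC] := hadapted.
pose i0 := tagnat.Rank 0 (Ordinal hr1).
pose i1 := tagnat.Rank 1 (Ordinal hr2).
pose i2 := tagnat.Rank 2 (Ordinal hr3).
pose f p s u v := mform g (elem R p s) (elem R u v).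
have fC p s u v : f p s u v = f u v p s by exact: mformC.
have f_anti p s u v : f p s u v = - f s p u v.
  by rewrite /f elemN (mformN hg).
have f_same p s u v : tagnat.sig1 p = tagnat.sig1 s -> f p s u v = 0.
  by move=> ps; rewrite /f elem_same // (mform0 hg).
(* The size 2l+1 is odd. *)
have card_I : #|'I_(\sum_i r i)| != 4%N.
  by rewrite card_ord big_ord4 /= hsum; lia.
have scal := block_form_scalar fC f_anti f_same (mform_elem_nat hg hLC)
  (tagnat.Rank1K (Ordinal hr1))
  (tagnat.Rank1K (Ordinal hr2)) (tagnat.Rank1K (Ordinal hr3)) card_I.
set t := f i0 i1 i0 i1 in scal.
have i01 : tagnat.sig1 i0 != tagnat.sig1 i1 by rewrite !tagnat.Rank1K.
(* The constant t is the squared norm of E_{i0 i1}, which is nonzero since its entry at (i0, i1) is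
   1. *)
exists t; split.
  rewrite /t /f mformE; try exact: m_elem.
  have [/(_ _ (SO1 _ _))[_ _ pos] _ _] := hg; apply: pos; first exact: m_elem.
  rewrite elem_neq //; apply/eqP => /matrixP /(_ i0 i1).
  rewrite !mxE !eqxx /=; have /negbTE-> : i0 != i1.
    by apply: contraNneq i01 => ->.
  by rewrite subr0 => /eqP; rewrite oner_eq0.
move=> X mX; rewrite -mformE // mform_sum //.
(* For a pair inside one diagonal block both sides vanish, because X does there; for other pairs
   [scal] applies. *)
have term p q u v : X p q * X u v * mform g (delta_mx p q) (delta_mx u v) =
    4^-1 * t * X p q *
    (X u v * ((p == u)%:R * (q == v)%:R) - X u v * ((q == u)%:R * (p == v)%:R)).
  have X0 a b : tagnat.sig1 a == tagnat.sig1 b -> X a b = 0.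
    by move=> ab; rewrite -[X](projm_id mX) projmE ab.
  rewrite mform_delta //.
  have [/X0->|pq] := boolP (tagnat.sig1 p == tagnat.sig1 q).
    by rewrite !(mul0r, mulr0, subrr).
  have [/X0->|uv] := boolP (tagnat.sig1 u == tagnat.sig1 v).
    by rewrite !(mul0r, mulr0, subrr).
  rewrite [mform _ _ _](scal _ _ _ _ pq uv) -/t.
  by clearbody t; ring.
have sum_delta p q : \sum_u \sum_v X u v * ((p == u)%:R * (q == v)%:R) = X p q.
  rewrite (bigD1 p) //= [X in _ + X]big1 ?addr0; last first.
    move=> u /negbTE up; rewrite big1 // => v _.
    by rewrite eq_sym up mul0r mulr0.
  rewrite (bigD1 q) //= [X in _ + X]big1 ?addr0 ?eqxx ?mulr1 // => v /negbTE vq.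
  by rewrite (eq_sym q) vq !mulr0.
transitivity (2^-1 * t * \sum_p \sum_q X p q ^+ 2); last first.
  by rewrite sumsq_m //; field.
rewrite mulr_sumr; apply: eq_bigr => p _; rewrite mulr_sumr; apply: eq_bigr => q _.
(* The sum over u and v leaves X p q - X q p, which is 2 X p q by skewness. *)
transitivity (4^-1 * t * X p q * (X p q - X q p)).
  rewrite -[in X in _ * X](sum_delta p q) -(sum_delta q p) -sumrB mulr_sumr.
  apply: eq_bigr => u _; rewrite -sumrB mulr_sumr; apply: eq_bigr => v _.
  exact: term.
have -> : X q p = - X p q.
  by have /matrixP/(_ p q) := so_m mX; rewrite !mxE.
by field.
Qed.
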